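(* Let $\mathcal{X}$ and $\mathcal{Y}$ be Polish spaces with their Borel $\sigma$-algebras, let $\mu$ be a probability measure on $\mathcal{X}$, let $\gamma(dy|x)$ be a stochastic kernel on $\mathcal{Y}$ given $\mathcal{X}$, and let $F:\mathcal{X}\times\mathcal{Y}\to\mathbb{R}$ be Borel measurable and bounded from below. For $c\in(0,\infty)$ define $$\bar\Lambda_c^2=\frac1c\int_{\mathcal{X}}\left[\log\int_{\mathcal{Y}}e^{cF(x,y)}\,\gamma(dy|x)\right]\mu(dx)\in(-\infty,\infty].$$ Then for every $c\in(0,\infty)$ and every stochastic kernel $\theta(dy|x)$ on $\mathcal{Y}$ given $\mathcal{X}$, $$\int_{\mathcal{X}}\int_{\mathcal{Y}}F(x,y)\,\theta(dy|x)\,\mu(dx)\le\frac1c\int_{\mathcal{X}}R\big(\theta(\cdot|x)\,\|\,\gamma(\cdot|x)\big)\,\mu(dx)+\bar\Lambda_c^2 .$$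
   Context: For probability measures $\nu,\gamma$ on the same Polish space, the relative entropy is $R(\nu\|\gamma)=\int\log\left(\frac{d\nu}{d\gamma}\right)d\nu$ if $\nu$ is absolutely continuous with respect to $\gamma$ and $\log\frac{d\nu}{d\gamma}$ is $\nu$-integrable, and $R(\nu\|\gamma)=\infty$ otherwise; it is always non-negative. A stochastic kernel on $\mathcal{Y}$ given $\mathcal{X}$ is a family of probability measures on $\mathcal{Y}$ indexed by $x\in\mathcal{X}$, depending measurably on $x$. Integrals may take the value $+\infty$, with the convention $\log\infty=\infty$. *)

(* Defs.v *)
From HB Require Import structures.
From mathcomp Require Import all_boot all_order all_algebra.
From mathcomp Require Import all_classical all_reals all_analysis.

Set Implicit Arguments.
Unset Strict Implicit.
Unset Printing Implicit Defensive.

Import Order.TTheory GRing.Theory Num.Theory.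

Local Open Scope classical_set_scope.
Local Open Scope ring_scope.
Local Open Scope charge_scope.

Definition separable (T : topologicalType) : Prop :=
  exists2 D : set T, countable D & dense D.

Definition completely_metrizable (R : realType) (T : topologicalType) : Prop :=
  exists d : T -> T -> R,
    [/\ forall x y, 0 <= d x y,
        forall x y, d x y = 0 <-> x = y,
        forall x y, d x y = d y x,
        forall x y z, d x z <= d x y + d y z &
        [/\ (forall (x : T) (A : set T),
               nbhs x A <-> exists2 e, 0 < e & [set y | d x y < e] `<=` A)
          & forall u : nat -> T,
              (forall e, 0 < e -> exists N : nat, forall m n : nat,
                 (N <= m)%N -> (N <= n)%N -> d (u m) (u n) < e) ->
              exists l : T, u @ \oo --> l]].

Definition polish (R : realType) (T : topologicalType) : Prop :=
  separable T /\ completely_metrizable R T.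

Notation borelType T := (g_sigma_algebraType (@open T)).

(* Where [nu `<< gamma], the library's density is finite everywhere and
   nonnegative gamma-almost everywhere; [lne] is -oo on nonpositive values,
   which the density takes on a nu-null set only. *)
Definition relative_entropy d (T : measurableType d) (R : realType)
    (nu gamma : probability T R) : \bar R :=
  let logdens x := lne (('d (charge_of_finite_measure nu) '/d gamma) x) in
  if `[< nu `<< gamma /\ nu.-integrable [set: T] logdens >]
  then (\int[nu]_x logdens x)%E else +oo%E.

Section kernel_law.
Context d d' (X : measurableType d) (Y : measurableType d') (R : realType).
Variables (k : R.-pker X ~> Y) (x : X).

(* The library types [k x] as a measure only; this bundles its total mass. *)
Definition kernel_law : set Y -> \bar R := k x.

HB.instance Definition _ := Measure.on kernel_law.

Let kernel_law_setT : kernel_law [set: Y] = 1%E.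
Proof. exact: prob_kernel. Qed.

HB.instance Definition _ :=
  Measure_isProbability.Build _ _ _ kernel_law kernel_law_setT.

End kernel_law.

(* Main.v *)
(** Pointwise in [x], the inequality is Gibbs' variational principle
    [\int g dnu <= R(nu || gamma) + log \int e^g dgamma] for [g = c F(x, .)].
    With [q = dnu/dgamma], [z = \int e^g dgamma] and [w = e^g / (z q)], one has
    [\int w dnu <= 1], and the principle is the [nu]-integral of
    [g - log q - log z = log w <= w - 1]. Integrating against [mu] does not
    require [x |-> R(theta(.|x) || gamma(.|x))] to be measurable: the other two
    functions of [x] are measurable, which is enough to bound the lower
    integral of the relative entropy from below. Measurability of these two
    uses that, [X] and [Y] being second countable, the Borel sets of [X * Y]
    lie in the product sigma-algebra. *)

Require Import Defs.
From HB Require Import structures.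
From mathcomp Require Import all_boot all_order all_algebra.
From mathcomp Require Import all_classical all_reals all_analysis.
From mathcomp Require Import measurable_realfun lra.

Set Implicit Arguments.
Unset Strict Implicit.
Unset Printing Implicit Defensive.

Import Order.TTheory GRing.Theory Num.Theory.

Local Open Scope classical_set_scope.
Local Open Scope ring_scope.
Local Open Scope ereal_scope.

(** * Countable bases and Borel sets of the product *)

(** The balls of radius [1/(n+1)] centred at the points of a countable dense set form a base. *)
Lemma separable_metrizable_second_countable (R : realType)
    (T : topologicalType) :
  separable T -> completely_metrizable R T -> @second_countable T.
Proof.
move=> [D cD dD] [d [d0 d00 dC dtri [nbhsd _]]].
pose ball (z : T * nat) := [set y | (d z.1 y < z.2.+1%:R^-1)%R].
have dxx x : d x x = 0%R by exact/d00.
have oball z : open (ball z).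
  rewrite openE => y /= yz; rewrite /interior nbhsd.
  exists (z.2.+1%:R^-1 - d z.1 y)%R; first by rewrite subr_gt0.
  move=> w /=; rewrite /ball/= ltrBrDl.
  exact/le_lt_trans/dtri.
exists (ball @` (D `*` [set: nat])).
  apply: sub_countable (card_image_le _ _) _.
  exact: countableX.
split=> [_ [z _ <-]|x A]; first exact: oball.
rewrite nbhsd => -[e e0 eA].
(* Half of [e], because a point of the ball around [y] is reached from [x] in two steps, through
   [y]. *)
have [n ne] : exists n : nat, (n.+1%:R^-1 < e / 2)%R.
  have [|n] := @ltr_add_invr R 0 (e / 2); first by rewrite divr_gt0.
  by rewrite add0r; exists n.
have [y [/= xy Dy]] : ball (x, n) `&` D !=set0.
  by apply: dD; [exists x; rewrite /ball/= dxx | exact: oball].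
exists (ball (y, n)) => /=.
  by split; [exists (y, n) | rewrite /ball/= dC].
move=> w yw; apply: eA => /=.
rewrite (le_lt_trans (dtri x y w))// (splitr e) ltrD//.
- exact: lt_trans xy ne.
- exact: lt_trans yw ne.
Qed.

(** [O] is the union of the rectangles it contains whose sides are basic open sets, and there are
    only countably many of them. *)
Lemma measurable_open_prod (X Y : ptopologicalType) (O : set (X * Y)) :
  @second_countable X -> @second_countable Y -> open O ->
  @measurable _ (borelType X * borelType Y)%type O.
Proof.
move=> [BX cBX [BXo BXb]] [BY cBY [BYo BYb]] Oo.
pose I := [set UV : set X * set Y |
  [/\ BX UV.1, BY UV.2 & UV.1 `*` UV.2 `<=` O]].
have -> : O = \bigcup_(UV in I) (UV.1 `*` UV.2).
  apply/seteqP; split => [[x y] Oxy|xy [UV [_ _]]]; last exact.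
  have : nbhs (x, y) O by apply: open_nbhs_nbhs.
  move=> [[P Q] [/= /BXb[U [BU Ux] UP] /BYb[V [BV Vy] VQ]] PQO].
  exists (U, V) => //; split => //= -[a b] [/= Ua Vb].
  by apply: PQO; split; [exact: UP | exact: VQ].
rewrite bigcup_set_type; apply: countable_bigcupT_measurable.
  rewrite (eq_countable (card_setT _)).
  apply: (@sub_countable _ _ _ (BX `*` BY)); last exact: countableX.
  by apply: subset_card_le => UV [].
move=> [/= UV /set_mem[BU BV _]]; apply: measurableX; apply: sub_sigma_algebra.
- exact: BXo.
- exact: BYo.
Qed.

Lemma measurable_fun_borel_prod (X Y : ptopologicalType) d
    (Z : measurableType d) (F : X * Y -> Z) :
  @second_countable X -> @second_countable Y ->
  measurable_fun [set: borelType (X * Y)%type]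
    (F : borelType (X * Y)%type -> Z) ->
  measurable_fun [set: (borelType X * borelType Y)%type]
    (F : (borelType X * borelType Y)%type -> Z).
Proof.
move=> cX cY mF _ A mA; have := mF measurableT A mA; rewrite !setTI => FA.
have : <<s @open (X * Y)%type >> `<=`
    @measurable _ (borelType X * borelType Y)%type.
  apply: smallest_sub; first exact: sigma_algebra_measurable.
  by move=> O; exact: measurable_open_prod.
exact.
Qed.

(** * Lower integrals of nonnegative functions *)

(* Without measurability, [\int] of a nonnegative function is its lower
   integral, which is still monotone. *)
Lemma ge0_le_lower_integral d (T : measurableType d) (R : realType)
    (mu : {measure set T -> \bar R}) (f g : T -> \bar R) :
  (forall x, 0 <= f x) -> (forall x, f x <= g x) ->
  \int[mu]_x f x <= \int[mu]_x g x.
Proof.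
move=> f0 fg; have g0 x : 0 <= g x by exact: le_trans (fg x).
rewrite !ge0_integralTE//; apply: ereal_sup_le.
by move=> _ [h hf <-]; exists h => // x; exact: le_trans (fg x).
Qed.

(** Additivity is applied only to the measurable functions [(f - g)^+] and [g]; the possibly
    non-measurable [h] enters by monotonicity, through [(f - g)^+ <= h]. *)
Lemma ge0_lower_integral_leD d (T : measurableType d) (R : realType)
    (mu : {measure set T -> \bar R}) (f g h : T -> \bar R) :
  measurable_fun [set: T] f -> measurable_fun [set: T] g ->
  (forall x, 0 <= f x) -> (forall x, 0 <= g x) -> (forall x, 0 <= h x) ->
  (forall x, f x <= h x + g x) ->
  \int[mu]_x f x <= \int[mu]_x h x + \int[mu]_x g x.
Proof.
move=> mf mg f0 g0 h0 fhg.
have mfg : measurable_fun [set: T] ((f \- g)^\+).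
  by apply: measurable_funepos; exact: emeasurable_funB.
apply: (@le_trans _ _ (\int[mu]_x ((f \- g)^\+ x + g x))).
  apply: ge0_le_lower_integral => // x; rewrite funeposE.
  have : f x - g x + g x <= maxe (f x - g x) 0 + g x.
    by rewrite leeD2r// le_max lexx.
  have := g0 x; case: (g x) => [r|_ _|//].
    by rewrite subeK.
  by rewrite addey ?leey// gt_eqF// (lt_le_trans ltNy0)// le_max lexx orbT.
rewrite ge0_integralD//; apply: leeD => //.
apply: ge0_le_lower_integral => // x; rewrite funeposE ge_max h0 andbT.
have := fhg x; have := g0 x; case: (g x) => [r _|_ _|//].
  by rewrite leeBlDr.
by rewrite addeNy leNye.
Qed.

(** * Integrals of functions bounded below, with value [+oo] allowed *)

Section bounded_below.
Context d (T : measurableType d) (R : realType) (P : probability T R).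
Variables (f : T -> \bar R) (b : R).
Hypotheses (mf : measurable_fun [set: T] f) (bf : forall x, b%:E <= f x).

Lemma integral_funeneg_fin_num : \int[P]_x f^\- x \is a fin_num.
Proof.
rewrite ge0_fin_numE ?integral_ge0//.
apply: (@le_lt_trans _ _ (\int[P]_x cst (`|b|%:E) x)).
  apply: ge0_le_lower_integral => // x.
  rewrite funenegE ge_max lee_fin normr_ge0 andbT.
  by rewrite leeNl (le_trans _ (bf x))// lee_fin lerNl -normrN ler_norm.
by rewrite integral_cst// [X in _ * X]probability_setT mule1 ltry.
Qed.

Lemma integral_subr_lower_bound :
  \int[P]_x (f x - b%:E) = \int[P]_x f x - b%:E.
Proof.
have fb0 x : 0 <= f x - b%:E by rewrite sube_ge0.
have mfb : measurable_fun [set: T] (fun x => f x - b%:E).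
  by apply: emeasurable_funB.
(* The identity [f - b = f^+ - f^- - b], rearranged so that every term is nonnegative and additivity
   holds even for infinite integrals. *)
have E : \int[P]_x (f x - b%:E) + (\int[P]_x f^\- x + (Num.max b 0)%:E) =
    \int[P]_x f^\+ x + (Num.max (- b) 0)%:E.
  have ce (r : R) : r%:E = \int[P]_x cst r%:E x.
    by rewrite integral_cst// [X in _ * X]probability_setT mule1.
  rewrite (ce (Num.max b 0)%R) (ce (Num.max (- b) 0)%R).
  have mx (r : R) : (0 <= Num.max r 0)%R by rewrite le_max lexx orbT.
  rewrite -!ge0_integralD//; last 6 first.
  - exact: measurable_funepos.
  - by move=> x _; rewrite lee_fin.
  - by move=> x _; rewrite adde_ge0// lee_fin.
  - by apply: emeasurable_funD => //; exact: measurable_funeneg.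
  - exact: measurable_funeneg.
  - by move=> x _; rewrite lee_fin.
  apply: eq_integral => x _ /=; rewrite funeposE funenegE.
  have := bf x; case: (f x) => [r|_|//].
    rewrite lee_fin => br; rewrite -!EFin_max -!EFinD; congr EFin.
    by rewrite /Num.max; do 4!case: ltP => ?; lra.
  by rewrite [maxe (- +oo) 0]maxNye maxye add0e !addye.
rewrite [in RHS]integralE.
have := integral_funeneg_fin_num.
move: E.
have : 0 <= \int[P]_x f^\+ x by exact: integral_ge0.
have : 0 <= \int[P]_x (f x - b%:E) by exact: integral_ge0.
(* Since the integral of [f^-] is finite, the other two are both finite or both [+oo]. *)
move: (integral _ _ _) (integral _ _ _) (integral _ _ _).
case=> [i| |//] [n| |] [p| |]// _ _; rewrite -?EFinD//.
move=> [E] _; congr EFin; move: E.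
by rewrite /Num.max; do 2!case: ltP => ?; lra.
Qed.

End bounded_below.

(** Positive and negative parts are compared separately; the convention [+oo - +oo = -oo] keeps the
    difference monotone without integrability. *)
Lemma ae_le_integral d (T : measurableType d) (R : realType)
    (mu : {measure set T -> \bar R}) (f g : T -> \bar R) :
  measurable_fun [set: T] f -> measurable_fun [set: T] g ->
  {ae mu, forall x, f x <= g x} -> \int[mu]_x f x <= \int[mu]_x g x.
Proof.
move=> mf mg fg; rewrite integralE [leRHS]integralE leeB//.
- apply: ae_ge0_le_integral => //; [exact: measurable_funepos..|].
  by apply: filterS fg => x fgx _; rewrite !funeposE le_max2.
- apply: ae_ge0_le_integral => //; [exact: measurable_funeneg..|].
  by apply: filterS fg => x fgx _; rewrite !funenegE le_max2// leeN2.
Qed.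

(** * Gibbs' variational principle *)

Section donsker_varadhan.
Context d (T : measurableType d) (R : realType) (nu gamma : probability T R).

Local Open Scope charge_scope.

(** Under absolute continuity, a version of the density that is finite and nonnegative everywhere;
    [logdens] uses the version from [relative_entropy]. *)
Let q := Radon_Nikodym_SigmaFinite.f nu gamma.
Let logdens x := lne (('d (charge_of_finite_measure nu) '/d gamma) x).

(** The two versions agree [gamma]-almost everywhere, hence [nu]-almost everywhere, and [nu] gives
    [{q = 0}] the mass of [q] over that set, which is 0. *)
Lemma ae_log_density : nu `<< gamma ->
  {ae nu, forall x, (0 < fine (q x))%R /\ logdens x = (ln (fine (q x)))%:E}.
Proof.
move=> nug.
have q0 : forall x, 0 <= q x := Radon_Nikodym_SigmaFinite.f_ge0 nug.
have qfin : forall x, q x \is a fin_num :=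
  Radon_Nikodym_SigmaFinite.f_fin_num nug.
have mq : measurable_fun [set: T] q.
  exact: measurable_int (Radon_Nikodym_SigmaFinite.f_integrable nug).
have qD : {ae nu, forall x, [set: T] x ->
    q x = ('d (charge_of_finite_measure nu) '/d gamma) x}.
  apply: (null_dominates_ae_eq measurableT nug).
  exact: ae_eq_Radon_Nikodym_SigmaFinite.
have q_neq0 : {ae nu, forall x, q x != 0}.
  exists (q @^-1` [set 0]); split.
  - by rewrite -[_ @^-1` _]setTI; exact: mq.
  - rewrite (Radon_Nikodym_SigmaFinite.f_integral nug); last first.
      by rewrite -[_ @^-1` _]setTI; exact: mq.
    by rewrite integral0_eq.
  - by move=> x /= /negP; rewrite negbK => /eqP.
apply: filterS2 qD q_neq0 => x qDx qx0.
have r0 : (0 < fine (q x))%R.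
  by rewrite fine_gt0// lt_neqAle eq_sym qx0 q0/= ltey_eq qfin.
by split => //; rewrite /logdens -qDx// -[in LHS](fineK (qfin x)) lne_EFin.
Qed.

Variables (g : T -> R) (b : R).
Hypotheses (mg : measurable_fun [set: T] g) (bg : forall x, (b <= g x)%R).

(** Keeps the logarithmic term away from [-oo], so that sums with [+oo] are harmless. *)
Lemma le_lne_integral_expR : b%:E <= lne (\int[gamma]_x (expR (g x))%:E).
Proof.
have -> : b%:E = lne ((expR b)%:E) by rewrite lne_EFin ?expR_gt0// expRK.
have : (expR b)%:E <= \int[gamma]_x (expR (g x))%:E.
  have -> : (expR b)%:E = \int[gamma]_x cst (expR b)%:E x.
    by rewrite integral_cst// [X in _ * X]probability_setT mule1.
  apply: ge0_le_lower_integral => x; rewrite lee_fin ?expR_ge0//.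
  by rewrite ler_expR.
move=> le; rewrite lee_lne// in_itv/= leey andbT.
  by rewrite lee_fin expR_ge0.
by apply: le_trans le; rewrite lee_fin expR_ge0.
Qed.

Lemma donsker_varadhan_fin : nu `<< gamma ->
  nu.-integrable [set: T] logdens ->
  \int[gamma]_x (expR (g x))%:E < +oo ->
  \int[nu]_x (g x)%:E <=
    \int[nu]_x logdens x + lne (\int[gamma]_x (expR (g x))%:E).
Proof.
move=> nug ilog Zoo.
have Z0 : 0 < \int[gamma]_x (expR (g x))%:E.
  rewrite ltNge; apply/negP => /le0_lneNy Z0.
  by have := le_lne_integral_expR; rewrite Z0.
have Zfin : \int[gamma]_x (expR (g x))%:E \is a fin_num.
  by rewrite ge0_fin_numE// ltW.
set z := fine (\int[gamma]_x (expR (g x))%:E).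
have zE : \int[gamma]_x (expR (g x))%:E = z%:E by rewrite fineK.
have z0 : (0 < z)%R by rewrite fine_gt0// Z0.
have q0 : forall x, 0 <= q x := Radon_Nikodym_SigmaFinite.f_ge0 nug.
have qfin : forall x, q x \is a fin_num :=
  Radon_Nikodym_SigmaFinite.f_fin_num nug.
have mq : measurable_fun [set: T] q.
  exact: measurable_int (Radon_Nikodym_SigmaFinite.f_integrable nug).
have mexp : measurable_fun [set: T] (fun x => (expR (g x))%:E).
  by apply/measurable_EFinP; exact: measurableT_comp.
(* This is [e^g / (z q)] where [q > 0]. Where [q = 0] it is still finite, so [w q = 0] there. *)
pose w x := expR (g x - ln z - ln (fine (q x))).
have mw : measurable_fun [set: T] (EFin \o w).
  apply/measurable_EFinP; apply: measurableT_comp => //.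
  apply: measurable_funB; first exact: measurable_funB.
  by apply: measurableT_comp => //; exact: measurableT_comp.
(* The [nu]-integral of [w] is the [gamma]-integral of [w q], and [w q <= e^g / z], with strict
   inequality where [q = 0]. *)
have int_w : \int[nu]_x (w x)%:E <= 1.
  rewrite -(Radon_Nikodym_SigmaFinite.change_of_variables nug)//; last first.
    by move=> x; rewrite lee_fin expR_ge0.
  have -> : 1 = \int[gamma]_x ((z^-1)%:E * (expR (g x))%:E).
    rewrite ge0_integralZl//.
    + by rewrite zE -EFinM mulVf// gt_eqF.
    + by rewrite lee_fin invr_ge0 ltW.
  apply: ge0_le_lower_integral => x.
    by rewrite mule_ge0// lee_fin expR_ge0.
  rewrite -/q -(fineK (qfin x)) -!EFinM lee_fin /w.
  have := fine_ge0 (q0 x); rewrite le_eqVlt => /predU1P[<-|r0].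
    by rewrite mulr0 mulr_ge0 ?expR_ge0// invr_ge0 ltW.
  by rewrite !expRB !lnK ?posrE// mulfVK ?gt_eqF// mulrC.
have iw : nu.-integrable [set: T] (EFin \o w).
  apply/integrableP; split => //.
  under eq_integral do rewrite /= ger0_norm ?expR_ge0//.
  by rewrite (le_lt_trans int_w)// ltry.
have ik : nu.-integrable [set: T] (cst (ln z - 1)%:E).
  exact: finite_measure_integrable_cst.
have mlog := measurable_int _ ilog.
(* The bound [1 + t <= e^t] at [t = g - ln z - ln q] gives the integrand; the [-1] then absorbs the
   integral of [w]. *)
apply: (@le_trans _ _
  (\int[nu]_x (logdens x + (cst (ln z - 1)%:E x + (EFin \o w) x)))).
  apply: ae_le_integral.
  - exact/measurable_EFinP.
  - by apply: emeasurable_funD => //; exact: emeasurable_funD.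
  - apply: filterS (ae_log_density nug) => x [r0 ->] /=.
    rewrite -!EFinD lee_fin.
    have := @expR_ge1Dx R (g x - ln z - ln (fine (q x))).
    by rewrite -/(w x); lra.
rewrite integralD//; last exact: integrableD.
rewrite leeD2l// integralD// integral_cst// [X in _ * X]probability_setT mule1.
rewrite zE lne_EFin// EFinB -[leRHS]adde0 -addeA leeD2l//.
by rewrite addeC sube_le0.
Qed.

(** In the cases left over, one term on the right is [+oo] and the other is not [-oo]. *)
Lemma donsker_varadhan :
  \int[nu]_x (g x)%:E <=
    relative_entropy nu gamma + lne (\int[gamma]_x (expR (g x))%:E).
Proof.
have lneNy : lne (\int[gamma]_x (expR (g x))%:E) != -oo.
  by rewrite gt_eqF// (lt_le_trans _ le_lne_integral_expR)// ltNyr.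
rewrite /relative_entropy; case: ifPn => [/asboolP[nug ilog]|_]; last first.
  by rewrite addye// leey.
have [Zoo|] := ltP (\int[gamma]_x (expR (g x))%:E) +oo.
  exact: donsker_varadhan_fin.
rewrite leye_eq => /eqP ->.
have : \int[nu]_x logdens x \is a fin_num by exact: integrable_fin_num.
by rewrite /= => /fineK <-; rewrite addey// leey.
Qed.

End donsker_varadhan.

(** The variational principle at [g = 0], whose logarithmic term is [log 1 = 0]. *)
Lemma relative_entropy_ge0 d (T : measurableType d) (R : realType)
    (nu gamma : probability T R) : 0 <= relative_entropy nu gamma.
Proof.
have := @donsker_varadhan _ T R nu gamma (cst 0%R) 0%R.
under eq_integral do rewrite /=.
rewrite integral0.
under eq_integral do rewrite /= expR0.
rewrite integral_cst// [X in _ * X]probability_setT mule1 lne1 adde0.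
by apply.
Qed.

(** * Measurability and scaling for the integrals over [Y] *)

Lemma measurable_lne (R : realType) : measurable_fun [set: \bar R] (@lne R).
Proof.
have -> : @lne R = fun x => if x == +oo then +oo else
    if x <= 0 then -oo else (ln (fine x))%:E.
  by apply/funext => -[r| |]//=; rewrite leNye.
apply: measurable_fun_ifT => //.
  apply: (measurable_fun_bool true); rewrite setTI.
  rewrite (_ : _ @^-1` _ = [set +oo]); first exact: emeasurable_set1.
  by apply/seteqP; split => x /eqP.
apply: measurable_fun_ifT => //.
  apply: (measurable_fun_bool true).
  exact: emeasurable_fun_infty_c.
by apply/measurable_EFinP; exact: measurableT_comp.
Qed.

Lemma le_integral_lower_bound d (T : measurableType d) (R : realType)
    (P : probability T R) (f : T -> \bar R) (m : R) :
  (forall x, m%:E <= f x) -> measurable_fun [set: T] f ->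
  m%:E <= \int[P]_x f x.
Proof.
move=> mfx mf; rewrite -sube_ge0// -integral_subr_lower_bound//.
by apply: integral_ge0 => x _; rewrite sube_ge0.
Qed.

(** Subtracting the lower bounds [m] and [c m] reduces this to nonnegative functions. *)
Lemma integralZl_lower_bound d (T : measurableType d) (R : realType)
    (P : probability T R) (f : T -> \bar R) (m c : R) :
  measurable_fun [set: T] f -> (forall x, m%:E <= f x) -> (0 < c)%R ->
  \int[P]_x (c%:E * f x) = c%:E * \int[P]_x f x.
Proof.
move=> mf mfx c0.
have mcf : measurable_fun [set: T] (fun x => c%:E * f x).
  exact: measurable_funeM.
have cmf x : (c * m)%:E <= c%:E * f x.
  by rewrite EFinM lee_pmul2l.
have := integral_subr_lower_bound P mcf cmf.
under eq_integral do rewrite EFinM -muleBr ?fin_num_adde_defl//.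
rewrite ge0_integralZl//; last 3 first.
- exact: emeasurable_funB.
- by move=> x _; rewrite sube_ge0.
- by rewrite lee_fin ltW.
rewrite integral_subr_lower_bound// muleBr ?fin_num_adde_defl// -EFinM.
by move=> /(congr1 (fun x => x + (c * m)%:E)); rewrite !subeK.
Qed.

Lemma measurable_fun_integral_pkernel d d' (X : measurableType d)
    (Y : measurableType d') (R : realType) (k : R.-pker X ~> Y)
    (f : X * Y -> R) (m : R) :
  measurable_fun [set: X * Y] f -> (forall z, (m <= f z)%R) ->
  measurable_fun [set: X] (fun x => \int[kernel_law k x]_y (f (x, y))%:E).
Proof.
move=> mf mfz.
have mfx x : measurable_fun [set: Y] (fun y => (f (x, y))%:E).
  by apply/measurable_EFinP; exact: measurableT_comp.
(* Shifted by [m] the integrand is nonnegative, so its kernel integral is measurable in [x]; the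
   shift is a constant because the kernel has mass 1. *)
rewrite (_ : (fun x => _) =
    (fun x => \int[kernel_law k x]_y ((f (x, y))%:E - m%:E) + m%:E)).
  apply: emeasurable_funD => //.
  apply: (measurable_fun_integral_finite_kernel
            (fun z => (f z)%:E - m%:E) k).
    by move=> z; rewrite sube_ge0// lee_fin.
  by apply: emeasurable_funB => //; exact/measurable_EFinP.
apply/funext => x.
by rewrite integral_subr_lower_bound ?subeK// => y; rewrite lee_fin.
Qed.

(** * Integration of the pointwise inequality over [X] *)

Theorem mainTheorem2 (R : realType) (X Y : ptopologicalType)
    (polishX : polish R X) (polishY : polish R Y)
    (mu : probability (borelType X) R)
    (gamma : R.-pker (borelType X) ~> (borelType Y))
    (F : X * Y -> R)
    (measF : measurable_fun [set: borelType (X * Y)%type]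
               (F : borelType (X * Y)%type -> R))
    (boundF : exists m : R, forall z : X * Y, (m <= F z)%R) :
  let Lambda (c : R) : \bar R :=
    (c^-1)%:E * \int[mu]_x lne (\int[gamma x]_y (expR (c * F (x, y)))%:E) in
  forall (c : R) (theta : R.-pker (borelType X) ~> (borelType Y)),
    (0 < c)%R ->
    \int[mu]_x \int[theta x]_y (F (x, y))%:E <=
    (c^-1)%:E * \int[mu]_x relative_entropy (kernel_law theta x)
                                            (kernel_law gamma x)
    + Lambda c.
Proof.
case: polishX polishY => [sX mX] [sY mY] Lambda c theta c0.
have [m mF] := boundF.
have cX := separable_metrizable_second_countable sX mX.
have cY := separable_metrizable_second_countable sY mY.
have mFp := measurable_fun_borel_prod cX cY measF.
have mFx (x : borelType X) :
    measurable_fun [set: borelType Y] (fun y : borelType Y => F (x, y)).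
  exact: (measurableT_comp mFp (measurable_pair1 x)).
pose h x := \int[kernel_law theta x]_y (F (x, y))%:E.
pose G x := lne (\int[kernel_law gamma x]_y (expR (c * F (x, y)))%:E).
pose E x := relative_entropy (kernel_law theta x) (kernel_law gamma x).
rewrite /Lambda -/E.
rewrite (_ : integral _ _ _ = \int[mu]_x h x)//.
rewrite (_ : integral mu _ (fun x => lne _) = \int[mu]_x G x)//.
have mcF x y : (c * m <= c * F (x, y))%R by rewrite ler_pM2l.
have mcFx (x : borelType X) :
    measurable_fun [set: borelType Y] (fun y : borelType Y => (c * F (x, y))%R).
  exact: measurable_funM.
have mh : measurable_fun [set: borelType X] h.
  exact: (measurable_fun_integral_pkernel theta mFp mF).
have mG : measurable_fun [set: borelType X] G.
  apply: (measurableT_comp (@measurable_lne R)).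
  apply: (@measurable_fun_integral_pkernel _ _ _ _ _ gamma
            (fun z => expR (c * F z)) 0%R) => [|z]; last exact: expR_ge0.
  by apply: measurableT_comp => //; exact: measurable_funM.
have hm x : m%:E <= h x.
  apply: le_integral_lower_bound; first by move=> y; rewrite lee_fin.
  exact/measurable_EFinP.
have Gm x : (c * m)%:E <= G x.
  exact: le_lne_integral_expR.
have hEG x : c%:E * h x <= E x + G x.
  rewrite -(@integralZl_lower_bound _ _ _ _ _ m)//; last 2 first.
  - exact/measurable_EFinP.
  - by move=> y; rewrite lee_fin.
  exact: (donsker_varadhan _ _ (mcFx x) (mcF x)).
have E0 x : 0 <= E x by exact: relative_entropy_ge0.
(* Subtracting [c m] from both sides makes the two measurable functions nonnegative, as the
   lower-integral inequality requires. *)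
have : \int[mu]_x (c%:E * h x - (c * m)%:E) <=
    \int[mu]_x E x + \int[mu]_x (G x - (c * m)%:E).
  apply: ge0_lower_integral_leD => //.
  - by apply: emeasurable_funB => //; exact: measurable_funeM.
  - exact: emeasurable_funB.
  - by move=> x; rewrite sube_ge0// EFinM lee_pmul2l.
  - by move=> x; rewrite sube_ge0.
  - by move=> x; rewrite addeA leeD2r.
rewrite !integral_subr_lower_bound//; last 2 first.
- exact: measurable_funeM.
- by move=> x; rewrite EFinM lee_pmul2l.
rewrite (@integralZl_lower_bound _ _ _ _ _ m)// addeA leeD2rE//.
have Glb : (c * m)%:E <= \int[mu]_x G x by exact: le_integral_lower_bound.
have Epos : 0 <= \int[mu]_x E x by exact: integral_ge0.
(* Factoring out [c^-1] needs a sum that is not [+oo - oo]: one integral is nonnegative, the other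
   at least [c m]. *)
rewrite -muleDr//; first by rewrite lee_pdivlMl.
case: (\int[mu]_x G x) Glb => // [r _|_]; first exact: fin_num_adde_defl.
by rewrite ge0_adde_def// inE ?leey.
Qed.
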